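(* Let $G$ be the Desargues graph with vertex set $V(G)=\{v_1,\dots,v_{20}\}$. Then $\mathcal{E}_G(v_i) = 1.6$ for every $1 \le i \le 20$.
   Context: For a simple graph $G$ with vertex set $\{v_1,\dots,v_n\}$ and adjacency matrix $A$, put $|A| = (AA^{T})^{1/2}$, the positive semidefinite square root. The energy of the vertex $v_i$ is $\mathcal{E}_G(v_i) = |A|_{ii}$. The Desargues graph is the generalized Petersen graph $GP(10,3)$, a $3$-regular graph on $20$ vertices. Its vertices are $u_0,\dots,u_9,w_0,\dots,w_9$, and its edges are $u_iu_{i+1}$, $u_iw_i$ and $w_iw_{i+3}$, with indices taken modulo $10$. *)

(* Defs.v *)
From HB Require Import structures.
From mathcomp Require Import all_boot all_order all_algebra.
From mathcomp Require Import boolp classical_sets reals.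
Set Implicit Arguments. Unset Strict Implicit. Unset Printing Implicit Defensive.
Import Order.TTheory GRing.Theory Num.Theory.
Local Open Scope ring_scope.

Record sgraph (V : finType) := SGraph {
  edge : rel V;
  edge_sym : symmetric edge;
  edge_irrefl : irreflexive edge
}.

(* [v] lists the vertices: the i-th row and column belong to the vertex [v i]. *)
Definition adjmx (R : realType) (V : finType) (G : sgraph V) (n : nat)
    (v : 'I_n -> V) : 'M[R]_n :=
  \matrix_(i, j) (edge G (v i) (v j))%:R.

Definition psdmx (R : realType) (n : nat) (M : 'M[R]_n) : Prop :=
  M^T = M /\ forall x : 'cV[R]_n, 0 <= (x^T *m M *m x) 0 0.

(* A positive semidefinite matrix has exactly one positive semidefinite square
   root; the value is the junk matrix 0 when [B] has none. *)
Definition psd_sqrtmx (R : realType) (n : nat) (B : 'M[R]_n) : 'M[R]_n :=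
  xget 0 [set M : 'M[R]_n | psdmx M /\ M *m M = B]%classic.

Definition absmx (R : realType) (n : nat) (A : 'M[R]_n) : 'M[R]_n :=
  psd_sqrtmx (A *m A^T).

Definition vertex_energy (R : realType) (V : finType) (G : sgraph V) (n : nat)
    (v : 'I_n -> V) (i : 'I_n) : R :=
  absmx (adjmx R G v) i i.

(* Vertices of GP(n, k): [inl i] is the outer vertex u_i and [inr i] is the
   inner vertex w_i. *)
Definition gp_edge (n k : nat) : rel ('I_n + 'I_n) := fun x y =>
  match x, y with
  | inl i, inl j => (j == i + 1 %[mod n])%N || (i == j + 1 %[mod n])%N
  | inr i, inr j => (j == i + k %[mod n])%N || (i == j + k %[mod n])%N
  | inl i, inr j | inr i, inl j => i == j
  end.

Lemma gp_edge_sym (n k : nat) : symmetric (@gp_edge n k).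
Proof. by case=> i [] j /=; rewrite 1?orbC // eq_sym. Qed.

Lemma gp_edge_irrefl (n k : nat) :
  (1 < n)%N -> ~~ (n %| k)%N -> irreflexive (@gp_edge n k).
Proof.
move=> n1 nk; have E (i m : nat) : (i == i + m %[mod n])%N = (n %| m)%N.
  by rewrite -[in LHS](addn0 i) -addnA eqn_modDl add0n mod0n eq_sym.
by case=> i /=; rewrite E orbb ?(negPf nk) // dvdn1; case: eqP n1 => // ->.
Qed.

Definition generalized_petersen (n k : nat) (n1 : (1 < n)%N)
    (nk : ~~ (n %| k)%N) : sgraph ('I_n + 'I_n)%type :=
  SGraph (@gp_edge_sym n k) (gp_edge_irrefl n1 nk).

Definition desargues : sgraph ('I_10 + 'I_10)%type :=
  @generalized_petersen 10 3 isT isT.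

(* Main.v *)
Require Import Defs.
From mathcomp Require Import all_boot all_order all_algebra.
From mathcomp Require Import boolp classical_sets reals.
From mathcomp Require Import ring lra.
Import Order.TTheory GRing.Theory Num.Theory.
Local Open Scope ring_scope.

(** The matrix B = A^2 is annihilated by (X - 1)(X - 4)(X - 9), so its positive
    semidefinite square root is p(B), where p = (36 + 25 X - X^2) / 60
    interpolates the square root at 1, 4 and 9. Every vertex starts 3 closed
    walks of length 2 and 15 of length 4, so the diagonal entries of p(B) are
    (36 + 25 * 3 - 15) / 60 = 8/5. *)

(** The diagonal entries of [N^T *m N] are the squared norms of the columns of [N]. *)
Lemma trmx_mul_eq0 (R : realType) (m n : nat) (N : 'M[R]_(m, n)) :
  N^T *m N = 0 -> N = 0.
Proof.
move=> N0; apply/matrixP => i j; rewrite mxE.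
have /eqP := congr1 (fun M : 'M_n => M j j) N0.
rewrite !mxE psumr_eq0 => [/allP/(_ i)|k _]; last by rewrite mxE -expr2 sqr_ge0.
by rewrite mem_index_enum mxE mulf_eq0 orbb => /(_ isT)/eqP.
Qed.

(** Polarization: basis vectors show that the diagonal of [S] vanishes, and the form at [e i + e j]
    is then [2 S i j]. *)
Lemma symmx_form_eq0 (R : realType) (n : nat) (S : 'M[R]_n) :
  S^T = S -> (forall x : 'cV[R]_n, (x^T *m S *m x) 0 0 = 0) -> S = 0.
Proof.
move=> St S0; apply/matrixP => i j; rewrite mxE.
pose e (k : 'I_n) : 'cV[R]_n := delta_mx k 0.
have eSe k l : ((e k)^T *m S *m e l) 0 0 = S k l.
  by rewrite trmx_delta -rowE -colE !mxE.
have mx11D (M N : 'M[R]_1) : (M + N) 0 0 = M 0 0 + N 0 0 by rewrite mxE.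
have := S0 (e i + e j).
rewrite [(_ + _)^T]raddfD /= mulmxDl mulmxDl !mulmxDr !mx11D !eSe.
have Sii k : S k k = 0 by rewrite -eSe S0.
have -> : S j i = S i j by rewrite -[in LHS]St mxE.
by rewrite !Sii; lra.
Qed.

Lemma psdmxD (R : realType) (n : nat) (M N : 'M[R]_n) :
  psdmx M -> psdmx N -> psdmx (M + N).
Proof.
move=> [Mt M0] [Nt N0]; split=> [|x]; first by rewrite linearD /= Mt Nt.
by rewrite mulmxDr mulmxDl mxE addr_ge0.
Qed.

Lemma psdmxZ (R : realType) (n : nat) (a : R) (M : 'M[R]_n) :
  0 <= a -> psdmx M -> psdmx (a *: M).
Proof.
move=> a0 [Mt M0]; split=> [|x]; first by rewrite linearZ /= Mt.
by rewrite -scalemxAr -scalemxAl mxE mulr_ge0.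
Qed.

Lemma psdmx_congr (R : realType) (m n : nat) (M : 'M[R]_m) (N : 'M[R]_(m, n)) :
  psdmx M -> psdmx (N^T *m M *m N).
Proof.
move=> [Mt M0]; split=> [|x]; first by rewrite !trmx_mul trmxK Mt mulmxA.
by have := M0 (N *m x); rewrite trmx_mul !mulmxA.
Qed.

Lemma psdmx1 (R : realType) (n : nat) : psdmx (1%:M : 'M[R]_n).
Proof.
split=> [|x]; first exact: trmx1.
by rewrite mulmx1 mxE sumr_ge0 // => k _; rewrite mxE -expr2 sqr_ge0.
Qed.

Lemma psdmx_add_eq0 (R : realType) (n : nat) (M N : 'M[R]_n) :
  psdmx M -> psdmx N -> M + N = 0 -> M = 0.
Proof.
move=> [Mt M0] [Nt N0] MN; apply: symmx_form_eq0 => // x.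
have := congr1 (fun S => (x^T *m S *m x) 0 0) MN.
rewrite mulmxDr mulmxDl mulmx0 mul0mx mxE [X in _ = X -> _]mxE.
by have := M0 x; have := N0 x; lra.
Qed.

(** Let [D = M - N]. Commutation gives [D (M + N) = 0], so the positive semidefinite matrices
    [D M D] and [D N D] sum to zero and both vanish; their difference is [D^3]. *)
Lemma psdmx_comm_sqr_inj (R : realType) (n : nat) (M N : 'M[R]_n) :
  psdmx M -> psdmx N -> M *m N = N *m M -> M *m M = N *m N -> M = N.
Proof.
move=> psdM psdN MN MM; apply/eqP; rewrite -subr_eq0; apply/eqP.
set D := M - N.
have Dt : D^T = D by rewrite linearB /= psdM.1 psdN.1.
have DMND : D *m (M + N) = 0.
  by rewrite mulmxBl !mulmxDr MM MN [X in X - _]addrC subrr.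
have psdDMD S : psdmx S -> psdmx (D *m S *m D).
  by move=> psdS; rewrite -{1}Dt; apply: psdmx_congr.
have sum0 : D *m M *m D + D *m N *m D = 0.
  by rewrite -mulmxDl -mulmxDr DMND mul0mx.
have DMD0 := psdmx_add_eq0 _ _ _ _ (psdDMD _ psdM) (psdDMD _ psdN) sum0.
have DND0 : D *m N *m D = 0 by move: sum0; rewrite DMD0 add0r.
have DDD0 : D *m D *m D = 0.
  transitivity (D *m M *m D - D *m N *m D); first by rewrite -mulmxBl -mulmxBr.
  by rewrite DMD0 DND0 subr0.
(* As [D] is symmetric, [D^4 = 0] forces [D^2 = 0], which in turn forces [D = 0]. *)
apply: trmx_mul_eq0; rewrite Dt; apply: trmx_mul_eq0.
by rewrite trmx_mul Dt mulmxA DDD0 mul0mx.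
Qed.

(** A competing root [N] commutes with [N *m N = B], hence with [M] by the commutation hypothesis,
    and commuting roots coincide. That hypothesis holds whenever [M] is a polynomial in [B]. *)
Lemma psd_sqrtmxE (R : realType) (n : nat) (B M : 'M[R]_n) :
  psdmx M -> M *m M = B ->
  (forall N : 'M[R]_n, N *m B = B *m N -> N *m M = M *m N) ->
  psd_sqrtmx B = M.
Proof.
move=> psdM MM comB; apply: xget_unique => // N [psdN NN].
apply: psdmx_comm_sqr_inj => //; last by rewrite NN.
by apply: comB; rewrite -NN mulmxA.
Qed.

Lemma absmx_spec149 (R : realType) (n : nat) (A : 'M[R]_n.+1) :
  A^T = A -> A ^+ 6 - 14%:R *: A ^+ 4 + 49%:R *: A ^+ 2 - 36%:R *: 1 = 0 ->
  absmx A = 60%:R^-1 *: (36%:R *: 1 + 25%:R *: A ^+ 2 - A ^+ 4).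
Proof.
move=> At mA; rewrite /absmx At.
have trA k : (A ^+ k)^T = A ^+ k.
  elim: k => [|k IH]; first exact: trmx1.
  rewrite exprS -[A * _]/(A *m _) trmx_mul IH At.
  by rewrite -[RHS]/(A * A ^+ k) -exprS exprSr.
(* Evaluation at [A] moves identities between polynomials in [A] to the commutative ring [{poly R}],
   where it suffices to exhibit a multiple of the annihilating polynomial. *)
pose h : {rmorphism {poly R} -> 'M[R]_n.+1} := horner_mx A.
have hX k : h ('X ^+ k) = A ^+ k by rewrite rmorphXn; congr (_ ^+ _); exact: horner_mx_X.
have hC a : h a%:R = a%:R *: 1 by rewrite rmorph_nat scaler_nat.
have hZ a p : h (a%:R * p) = a%:R *: h p.
  by rewrite rmorphM rmorph_nat scaler_nat mulr_natl.
have hm : h ('X ^+ 6 - 14%:R * 'X ^+ 4 + 49%:R * 'X ^+ 2 - 36%:R) = 0.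
  by rewrite rmorphB rmorphD rmorphB !hZ !hX hC.
(* With [t = A^2], [T = (9 - t)(t + 4)] takes the values 40, 40, 0 at [t] = 1, 4, 9, whence
   [T^2 = 40 T]. It is chosen so that [M] below equals [20 A^2 + T]. *)
pose T := 36%:R *: 1 + 5%:R *: A ^+ 2 - A ^+ 4.
have hT : h (36%:R + 5%:R * 'X ^+ 2 - 'X ^+ 4) = T.
  by rewrite rmorphB rmorphD hZ !hX hC.
have TT : T *m T = 40%:R *: T.
  rewrite -[LHS]/(T * T) -hT -rmorphM -hZ; apply/eqP; rewrite -subr_eq0 -rmorphB.
  rewrite [X in h X](_ : _ = ('X ^+ 6 - 14%:R * 'X ^+ 4 + 49%:R * 'X ^+ 2 - 36%:R)
    * ('X ^+ 2 + 4%:R)); last by ring.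
  by rewrite rmorphM hm mul0r.
set M := 36%:R *: 1 + _ - _.
have hM : h (36%:R + 25%:R * 'X ^+ 2 - 'X ^+ 4) = M.
  by rewrite rmorphB rmorphD hZ !hX hC.
(* The values of [M] at [t] = 1, 4, 9 are 60, 120, 180, that is 60 times the square root of [t]. *)
have MM : M *m M = 3600%:R *: (A *m A).
  rewrite -[LHS]/(M * M) -[A *m A]/(A ^+ 2) -hM -rmorphM -hX -hZ.
  apply/eqP; rewrite -subr_eq0 -rmorphB.
  rewrite [X in h X](_ : _ = ('X ^+ 6 - 14%:R * 'X ^+ 4 + 49%:R * 'X ^+ 2 - 36%:R)
    * ('X ^+ 2 - 36%:R)); last by ring.
  by rewrite rmorphM hm mul0r.
apply: psd_sqrtmxE.
- apply: psdmxZ; first by rewrite invr_ge0 ler0n.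
  (* T / 40 is the projection onto the eigenspaces of A^2 for 1 and 4. *)
  have -> : M = 20%:R *: (A^T *m 1%:M *m A) + 40%:R^-1 *: (T^T *m 1%:M *m T).
    have -> : T^T = T by rewrite /T linearB linearD /= !linearZ /= !trA trmx1.
    rewrite !mulmx1 TT scalerA mulVf ?pnatr_eq0 // scale1r At /M /T.
    rewrite -[A *m A]/(A ^+ 2) [RHS]addrA; congr (_ - _).
    by rewrite [RHS]addrCA -scalerDl -natrD.
  by apply: psdmxD; apply: psdmxZ; rewrite ?invr_ge0 ?ler0n //;
    apply: psdmx_congr; exact: psdmx1.
- rewrite -scalemxAl -scalemxAr MM !scalerA.
  by rewrite (_ : _ * _ = 1) ?scale1r //; field.
- move=> N; rewrite -[A *m A]/(A ^+ 2) => NA.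
  have NA2 : GRing.comm N (A ^+ 2) by exact: NA.
  have NA4 : GRing.comm N (A ^+ 4) by rewrite (exprM A 2 2); exact: commrX.
  rewrite -scalemxAr -scalemxAl; congr (_ *: _).
  rewrite /M !scaler_nat; apply: commrB => //; apply: commrD; apply: commrMn => //.
  exact: commr1.
Qed.

(* The vertices are coded by the naturals below 20, with w_i as 10 + i, so that
   walks can be counted by evaluation. *)
Definition desargues_nat (a b : nat) : bool :=
  match (a < 10)%N, (b < 10)%N with
  | true, true => (b == a + 1 %[mod 10])%N || (a == b + 1 %[mod 10])%N
  | false, false => (b == a + 3 %[mod 10])%N || (a == b + 3 %[mod 10])%N
  | true, false => (b == 10 + a)%N
  | false, true => (a == 10 + b)%N
  end.

Lemma desargues_natE (x y : 'I_10 + 'I_10) :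
  edge desargues x y = desargues_nat (unsplit x) (unsplit y).
Proof.
have lt10 (i : 'I_10) : (i < 10)%N = true by exact: ltn_ord.
have ge10 (i : 'I_10) : (10 + i < 10)%N = false by rewrite ltnNge leq_addr.
rewrite /desargues_nat; case: x y => i [] j /=; rewrite ?lt10 ?ge10 //.
by rewrite eqn_add2l eq_sym.
Qed.

(** Filtering by adjacency before recursing keeps the evaluation to actual walks. *)
Fixpoint walks (e : rel nat) (n k a b : nat) : nat :=
  if k is k'.+1 then
    sumn [seq walks e n k' c b | c <- iota 0 n & e a c]
  else (a == b).

(** The relabelling [s] absorbs the listing of the vertices, so one count on naturals serves every
    listing. *)
Lemma walks_adj (R : realType) (e : rel nat) (n : nat) (s : 'I_n.+1 -> 'I_n.+1)
    (A : 'M[R]_n.+1) :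
  bijective s -> (forall i j, A i j = (e (s i) (s j))%:R) ->
  forall k i j, (A ^+ k) i j = (walks e n.+1 k (s i) (s j))%:R.
Proof.
move=> bs AE; elim=> [|k IH] i j.
  by rewrite expr0 mxE /= val_eqE (inj_eq (bij_inj bs)).
rewrite exprS -[A * _]/(A *m _) mxE -[walks _ _ _ _ _]/(sumn
  [seq walks e n.+1 k c (s j) | c <- iota 0 n.+1 & e (s i) c]).
under eq_bigr => l _ do rewrite AE IH -natrM.
rewrite -natr_sum sumnE big_map big_filter; congr _%:R.
rewrite -[iota 0 n.+1]/(index_iota 0 n.+1) big_mkord [RHS]big_mkcond /=.
rewrite [RHS](reindex s) /=; last exact: onW_bij.
by apply: eq_bigr => l _; case: (e _ _); rewrite ?mul1n ?mul0n.
Qed.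

(** The last clause is the annihilation of [A^2] by [(t - 1)(t - 4)(t - 9)], read entrywise, with
    the negative terms moved across so that it lives in the naturals. *)
Lemma desargues_walks :
  all (fun a => (walks desargues_nat 20 2 a a == 3) &&
    (walks desargues_nat 20 4 a a == 15) &&
    all (fun b => walks desargues_nat 20 6 a b + 49 * walks desargues_nat 20 2 a b
         == 14 * walks desargues_nat 20 4 a b + 36 * (a == b)) (iota 0 20))%N
  (iota 0 20).
Proof. by vm_compute. Qed.

Theorem theorem4 (R : realType) (v : 'I_20 -> ('I_10 + 'I_10)%type)
    (hv : bijective v) (i : 'I_20) :
  vertex_energy R desargues v i = 16 / 10.
Proof.
pose s : 'I_20 -> 'I_20 := fun j => unsplit (v j).
have bs : bijective s.
  apply: (bij_comp (f := @unsplit 10 10)) hv.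
  by exists split; [exact: unsplitK | exact: splitK].
pose A := adjmx R desargues v.
have AE k l : A k l = (desargues_nat (s k) (s l))%:R.
  by rewrite mxE desargues_natE.
have AX := walks_adj _ _ _ _ A bs AE.
have in20 (k : 'I_20) : (k : nat) \in iota 0 20 by rewrite mem_iota ltn_ord.
have H k := allP desargues_walks _ (in20 (s k)).
rewrite /vertex_energy -/A absmx_spec149.
- have /andP[/andP[/eqP W2 /eqP W4] _] := H i.
  move: (AX 2 i i) (AX 4 i i); rewrite W2 W4.
  move: (A ^+ 2) (A ^+ 4) => A2 A4 A2i A4i.
  by rewrite !mxE eqxx A2i A4i mulr1n; lra.
- by apply/matrixP => k l; rewrite !mxE edge_sym.
- apply/matrixP => k l.
  have /andP[_ /allP/(_ _ (in20 (s l)))/eqP W] := H k.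
  have A0 : (1 : 'M[R]_20) k l = ((s k : nat) == s l)%:R.
    by rewrite -[1](expr0 A) AX.
  have natE (a b c d : nat) : (a + 49 * b = 14 * c + 36 * d)%N ->
      a%:R + 49%:R * b%:R = 14%:R * c%:R + 36%:R * d%:R :> R.
    by rewrite -!natrM -!natrD => ->.
  have := natE _ _ _ _ W; rewrite -!AX -A0 => WR.
  move: (A ^+ 2) (A ^+ 4) (A ^+ 6) WR => A2 A4 A6.
  by rewrite !mxE; lra.
Qed.
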